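(* The following two statements are equivalent: (A) (prime power conjecture) for every positive integer $q$, if there exists a perfect difference set of order $q$, then $q$ is a prime power; (B) for every integer $n\ge2$ such that $n-1$ is not a prime power, $$\inf_{|z_1|=\cdots=|z_n|=1}\ \max_{\nu=1,\dots,n^2-n}\left|\sum_{k=1}^n z_k^\nu\right| > \sqrt{n-1},$$ where the infimum is over all $n$-tuples of unimodular complex numbers.
   Context: A perfect difference set of order $q$ is a tuple of integers $(a_1,\ldots,a_{q+1})$ such that the differences $a_i-a_j$ with $i\ne j$ represent all nonzero residues modulo $q^2+q+1$. *)

(* Defs.v *)
From HB Require Import structures.
From mathcomp Require Import all_boot all_order all_algebra.
From mathcomp Require Import complex.
From mathcomp Require Import all_classical all_reals.

Set Implicit Arguments.
Unset Strict Implicit.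
Unset Printing Implicit Defensive.

Import Order.TTheory GRing.Theory Num.Theory.

Local Open Scope classical_set_scope.
Local Open Scope ring_scope.

Definition perfect_difference_set (q : nat) (a : 'I_q.+1 -> int) : Prop :=
  let m : int := (q ^ 2 + q + 1)%N in
  forall r : int, ~ (m %| r)%Z ->
    exists i j : 'I_q.+1, i != j /\ (a i - a j = r %[mod m])%Z.

(* The exponent 0 is allowed: 1 counts as a prime power. (0, 1) is a perfect
   difference set of order 1, so the prime power conjecture needs this. *)
Definition prime_power (q : nat) : Prop :=
  exists p k : nat, prime p /\ q = (p ^ k)%N.

Definition unimodular (R : realType) (n : nat) (z : 'I_n -> R[i]) : Prop :=
  forall k, Normc.normc (z k) = 1.

(* For n >= 2 the range of nu is nonempty; the moduli are nonnegative, so the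
   default value 0 does not affect the maximum. *)
Definition max_power_sum (R : realType) (n : nat) (z : 'I_n -> R[i]) : R :=
  \big[Num.max/0]_(1 <= nu < (n ^ 2 - n).+1)
    Normc.normc (\sum_(k < n) z k ^+ nu).

Definition inf_max_power_sum (R : realType) (n : nat) : R :=
  inf [set max_power_sum z | z in @unimodular R n].

(* Main.v *)
Require Import Defs.
From mathcomp Require Import all_boot all_order all_algebra.
From mathcomp Require Import cyclic separable cyclotomic complex ring.
From mathcomp Require Import all_classical all_reals all_analysis.

(** Put [q = n - 1] and [m = q^2 + q + 1], let [s_nu] be the power sums of
    unimodular [z_k], and write [D_m u] for [1 + u + ... + u^(m-1)].  Both sides
    of [\sum_(j, k) |D_m (z_j / z_k)|^2 = \sum_(a, b < m) |s_(a - b)|^2] equal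
    [\sum_(j, k, a, b) (z_j / z_k)^(a - b)].  Keeping only the diagonal [j = k]
    on the left shows that [|s_nu|^2 <= c] for [0 < nu < m] forces
    [(m - 1) c >= n (m - n)].  For [c = q] this is an equality, so every
    [D_m (z_j / z_k)] with [j <> k] vanishes, every [z_j / z_k] is an [m]-th
    root of unity, and [|s_nu|^2 = q].
    When [z_k = om^(a_k)] for a primitive [m]-th root of unity [om], the numbers
    [|s_nu|^2] are the Fourier transform on [Z/m] of the counts of pairs with
    [a_j - a_k = r], so they are all equal to [q] exactly when every nonzero
    residue occurs once.  By compactness the infimum is attained, hence it is at
    most [sqrt q] exactly when a perfect difference set of order [q] exists. *)

Set Implicit Arguments.
Unset Strict Implicit.
Unset Printing Implicit Defensive.

Import Order.TTheory GRing.Theory Num.Theory.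
Import numFieldNormedType.Exports.

Local Open Scope ring_scope.

Lemma exists_prim_root (F : closedFieldType) (m : nat) :
  m%:R != 0 :> F -> exists om : F, m.-primitive_root om.
Proof.
move=> natr_m_neq0; have m_gt0 : (0 < m)%N.
  by case: m natr_m_neq0 => //; rewrite eqxx.
have [rs] := closed_field_poly_normal ('X^m - 1 : {poly F}).
rewrite (monicP (monicXnsubC 1 m_gt0)) scale1r => rsE.
have /hasP[om _ om_prim] : has m.-primitive_root rs; last by exists om.
apply: has_prim_root => //.
- by apply/allP => u urs; rewrite /root_of_unity rsE root_prod_XsubC.
- by rewrite -separable_prod_XsubC -rsE separable_Xn_sub_1.
- by rewrite -ltnS -(size_prod_XsubC rs id) -rsE size_XnsubC.
Qed.

Lemma big_pair_diag (R : Type) (idx : R) (op : Monoid.com_law idx)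
    (I : finType) (F : I * I -> R) :
  \big[op/idx]_p F p =
    op (\big[op/idx]_i F (i, i)) (\big[op/idx]_(p | p.1 != p.2) F p).
Proof.
rewrite (bigID (fun p : I * I => p.1 == p.2)) /=; congr (op _ _).
rewrite (eq_bigr (fun p => F (p.1, p.2))) => [|[] //].
rewrite -(pair_big_dep xpredT (fun i j => i == j) (fun i j => F (i, j))).
by apply: eq_bigr => i _; rewrite (big_pred1 i) // => j; rewrite eq_sym.
Qed.

Lemma card_off_diag (I : finType) :
  #|[pred p : I * I | p.1 != p.2]| = (#|I| * #|I|.-1)%N.
Proof.
have := big_pair_diag addn (fun _ : I * I => 1%N).
rewrite !sum1_card card_prod => card_prodE.
by rewrite -subn1 mulnBr muln1 card_prodE addKn.
Qed.

Section PrimitiveRoot.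
Variables (F : fieldType) (m : nat) (om : F).
Hypothesis om_prim : m.-primitive_root om.

Lemma prim_exprz_eq1 (r : int) : (om ^ r == 1) = (m %| r)%Z.
Proof.
by rewrite dvdzE (prim_order_dvd om_prim); case: r => n //; rewrite invr_eq1.
Qed.

Lemma prim_root_neq0 : om != 0.
Proof. by rewrite (prim_root_eq0 om_prim) -lt0n (prim_order_gt0 om_prim). Qed.

Lemma eq_prim_exprz (r s : int) : (om ^ r == om ^ s) = (r == s %[mod m])%Z.
Proof.
rewrite eqz_mod_dvd -prim_exprz_eq1 expfzDr ?prim_root_neq0 // -invr_expz.
apply/eqP/eqP => [->|/divr1_eq //].
by rewrite divff // expfz_neq0 // prim_root_neq0.
Qed.

Lemma sum_prim_exprz (r : int) :
  \sum_(i < m) om ^ (i%:Z * r) = if (m %| r)%Z then m%:R else 0.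
Proof.
under eq_bigr do rewrite mulrC -exprz_exp -exprnP.
rewrite -prim_exprz_eq1; have [->|om_r] := eqVneq (om ^ r) 1.
  by under eq_bigr do rewrite expr1n; rewrite sumr_const card_ord.
apply/eqP; have /esym/eqP := subrX1 (om ^ r) m.
rewrite exprnP exprzAC -exprnP (prim_expr_order om_prim) exp1rz subrr.
by rewrite mulf_eq0 subr_eq0 (negPf om_r).
Qed.

Lemma sum_prim_exprz_neq0 (r : int) :
  ~~ (m %| r)%Z -> \sum_(i < m | (i : nat) != 0%N) om ^ (i%:Z * r) = -1.
Proof.
move=> r_ndvd; have := sum_prim_exprz r.
rewrite (negPf r_ndvd) (bigD1 (Ordinal (prim_order_gt0 om_prim))) //= mul0r.
by move/eqP; rewrite addrC addr_eq0 => /eqP.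
Qed.

End PrimitiveRoot.

Lemma norm_prim_exprz (F : numFieldType) (m : nat) (om : F) (r : int) :
  m.-primitive_root om -> `|om ^ r| = 1.
Proof.
move=> om_prim; have m_gt0 := prim_order_gt0 om_prim.
apply/eqP; rewrite -(@pexpr_eq1 _ _ m) // -normrX exprnP exprzAC -exprnP.
by rewrite (prim_expr_order om_prim) exp1rz normr1.
Qed.

Definition power_sum (F : fieldType) (I : finType) (z : I -> F) (nu : int)
  : F := \sum_k z k ^ nu.

Lemma power_sumZ (F : fieldType) (I : finType) (u : F) (z : I -> F) (nu : int) :
  power_sum (fun k => u * z k) nu = u ^ nu * power_sum z nu.
Proof.
by rewrite /power_sum mulr_sumr; apply: eq_bigr => k _; rewrite expfzMl.
Qed.

Lemma power_sum0 (F : fieldType) (I : finType) (z : I -> F) :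
  power_sum z 0 = #|I|%:R.
Proof. by rewrite /power_sum (eq_bigr _ (fun _ _ => expr0z _)) sumr_const. Qed.

Lemma conjC_unimodular (C : numClosedFieldType) (x : C) :
  `|x| = 1 -> x^* = x^-1.
Proof. by move=> x1; rewrite invC_norm x1 expr1n invr1 mul1r. Qed.

Section UnimodularPowerSum.
Variables (C : numClosedFieldType) (I : finType) (z : I -> C).
Hypothesis norm_z : forall k, `|z k| = 1.

Lemma conjC_power_sum (nu : int) : (power_sum z nu)^* = power_sum z (- nu).
Proof.
rewrite /power_sum rmorph_sum; apply: eq_bigr => k _.
by rewrite /= fmorphXz /= conjC_unimodular // exprz_inv.
Qed.

Lemma norm_power_sum_abs (nu : int) :
  `|power_sum z `|nu|%N| = `|power_sum z nu|.
Proof. by case: (intP nu) => // n; rewrite -conjC_power_sum norm_conjC. Qed.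

Lemma sqr_norm_power_sum (nu : int) :
  `|power_sum z nu| ^+ 2 = \sum_(p : I * I) (z p.1 / z p.2) ^ nu.
Proof.
rewrite normCK conjC_power_sum big_distrlr pair_bigA; apply: eq_bigr => p _ /=.
by rewrite expfzMl exprz_inv.
Qed.

End UnimodularPowerSum.

Definition dirichlet_kernel (F : pzRingType) (m : nat) (u : F) : F :=
  \sum_(a < m) u ^+ a.

Section WelchBound.
Variables (C : numClosedFieldType) (I : finType) (z : I -> C) (m : nat).
Hypothesis norm_z : forall k, `|z k| = 1.

Lemma sum_sqr_norm_dirichlet_kernel :
  \sum_p `|dirichlet_kernel m (z p.1 / z p.2)| ^+ 2 =
  \sum_(d : 'I_m * 'I_m) `|power_sum z (d.1%:Z - d.2%:Z)| ^+ 2.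
Proof.
have norm_ratio p : `|z p.1 / z p.2| = 1 by rewrite normf_div !norm_z divr1.
under [RHS]eq_bigr do rewrite sqr_norm_power_sum //.
rewrite exchange_big; apply: eq_bigr => p _ /=.
have norm_powers (a : 'I_m) : `|(z p.1 / z p.2) ^+ a| = 1.
  by rewrite normrX norm_ratio expr1n.
have -> : dirichlet_kernel m (z p.1 / z p.2) =
    power_sum (fun a : 'I_m => (z p.1 / z p.2) ^+ a) 1 by [].
rewrite (sqr_norm_power_sum norm_powers); apply: eq_bigr => d _.
rewrite expr1z expfzDr; last by rewrite -normr_gt0 norm_ratio.
by rewrite -invr_expz.
Qed.

Lemma welch_identity (c : C) :
  \sum_(d : 'I_m * 'I_m | d.1 != d.2)
      (c - `|power_sum z (d.1%:Z - d.2%:Z)| ^+ 2)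
    + \sum_(p | p.1 != p.2) `|dirichlet_kernel m (z p.1 / z p.2)| ^+ 2
  = m%:R * ((m%:R - 1) * c - #|I|%:R * (m%:R - #|I|%:R)).
Proof.
have := sum_sqr_norm_dirichlet_kernel.
rewrite big_pair_diag [RHS]big_pair_diag /=.
under eq_bigr => k _.
  rewrite /dirichlet_kernel divff -?normr_gt0 ?norm_z //.
  under eq_bigr do rewrite expr1n.
  rewrite sumr_const card_ord normr_nat; over.
under [X in _ = X + _]eq_bigr do rewrite subrr power_sum0 normr_nat.
rewrite !sumr_const card_ord sumrB sumr_const card_off_diag card_ord.
have off_diagE : (m * m.-1)%:R = m%:R * (m%:R - 1) :> C.
  by case: (m) => [|k]; rewrite natrM ?mul0r // -natr1 addrK.
rewrite -[c *+ _]mulr_natr off_diagE addrAC => /(canRL (addKr _)) ->; ring.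
Qed.

Section WelchEquality.
Variable c : C.
Hypothesis power_sum_le : forall nu : nat,
  (0 < nu < m)%N -> `|power_sum z nu| ^+ 2 <= c.
Hypothesis welch_tight : (m%:R - 1) * c <= #|I|%:R * (m%:R - #|I|%:R).

Let sqr_norm_power_sum_diff_le (d : 'I_m * 'I_m) :
  d.1 != d.2 -> `|power_sum z (d.1%:Z - d.2%:Z)| ^+ 2 <= c.
Proof.
move=> d_neq; rewrite -norm_power_sum_abs //; apply: power_sum_le.
rewrite absz_gt0 subr_eq0 eqz_nat d_neq /=.
case: (leqP d.2 d.1) => [le_d|/ltnW le_d].
  by rewrite distnEl // (leq_ltn_trans (leq_subr _ _)).
by rewrite distnEr // (leq_ltn_trans (leq_subr _ _)).
Qed.

Let welch_defects_eq0 :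
  (\sum_(d : 'I_m * 'I_m | d.1 != d.2)
      (c - `|power_sum z (d.1%:Z - d.2%:Z)| ^+ 2) == 0)
  && (\sum_(p | p.1 != p.2) `|dirichlet_kernel m (z p.1 / z p.2)| ^+ 2 == 0).
Proof.
have defect_ge0 : 0 <= \sum_(d : 'I_m * 'I_m | d.1 != d.2)
    (c - `|power_sum z (d.1%:Z - d.2%:Z)| ^+ 2).
  by apply: sumr_ge0 => d /sqr_norm_power_sum_diff_le; rewrite subr_ge0.
have kernel_ge0 :
    0 <= \sum_(p | p.1 != p.2) `|dirichlet_kernel m (z p.1 / z p.2)| ^+ 2.
  by apply: sumr_ge0 => p _; exact: exprn_ge0.
rewrite -paddr_eq0 // eq_le addr_ge0 // andbT welch_identity.
by rewrite mulr_ge0_le0 ?ler0n // subr_le0.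
Qed.

Lemma welch_equality_sqr_norm (nu : nat) :
  (0 < nu < m)%N -> `|power_sum z nu| ^+ 2 = c.
Proof.
case/andP=> nu_gt0 nu_lt; have [/eqP defect0 _] := andP welch_defects_eq0.
have m_gt0 := ltn_trans nu_gt0 nu_lt.
have := psumr_eq0P _ defect0 (i := (Ordinal nu_lt, Ordinal m_gt0)).
rewrite /= subr0 -val_eqE /= gtn_eqF // => /(_ _ isT) defect_nu.
apply/esym/eqP; rewrite -subr_eq0 defect_nu // => d.
by move/sqr_norm_power_sum_diff_le; rewrite subr_ge0.
Qed.

Lemma welch_equality_ratio (j k : I) : (z j / z k) ^+ m = 1.
Proof.
have [->|jk] := eqVneq j k.
  by rewrite divff ?expr1n // -normr_gt0 norm_z.
have [_ /eqP kernel0] := andP welch_defects_eq0.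
have /eqP :=
  psumr_eq0P (fun p _ => exprn_ge0 2 (normr_ge0 _)) kernel0 (i := (j, k)) jk.
rewrite sqrf_eq0 normr_eq0 => /eqP kernel_jk.
by apply/eqP; rewrite -subr_eq0 subrX1 [X in _ * X]kernel_jk mulr0.
Qed.

End WelchEquality.
End WelchBound.

Definition difference_count (I : finType) (m : nat) (a : I -> int) (r : int)
  : nat :=
  #|[pred p : I * I | (a p.1 - a p.2 == r %[mod m])%Z]|.

Lemma exists_ord_residue (m : nat) (r : int) :
  (0 < m)%N -> exists i : 'I_m, forall j : 'I_m, (r == j %[mod m])%Z = (j == i).
Proof.
move=> m_gt0; have m_neq0 : m%:Z != 0 by rewrite -lt0n.
have res_lt : (`|(r %% m)%Z| < m)%N.
  by rewrite -ltz_nat gez0_abs ?modz_ge0 ?ltz_mod.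
exists (Ordinal res_lt) => j; rewrite -val_eqE /= -eqz_nat.
by rewrite gez0_abs ?modz_ge0 // [(j %% m)%Z]modz_nat modn_small // eq_sym.
Qed.

Section DifferenceCount.
Variables (I : finType) (m : nat) (a : I -> int).
Hypothesis m_gt0 : (0 < m)%N.

Lemma sum_differences (V : nmodType) (F : int -> V) :
    (forall r s, (r = s %[mod m])%Z -> F r = F s) ->
  \sum_(p : I * I) F (a p.1 - a p.2) =
    \sum_(r < m) F r *+ difference_count m a r.
Proof.
move=> F_mod; under [RHS]eq_bigr do rewrite -sumr_const.
rewrite (exchange_big_dep xpredT) //=; apply: eq_bigr => p _.
have [i iP] := exists_ord_residue (a p.1 - a p.2) m_gt0.
by rewrite (big_pred1 _ iP); apply/F_mod/eqP; rewrite iP.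
Qed.

Lemma sum_difference_count : (\sum_(r < m) difference_count m a r = #|I| ^ 2)%N.
Proof.
have := @sum_differences nat (fun=> 1%N) (fun _ _ _ => erefl).
rewrite sum1_card card_prod mulnn => ->.
by apply: eq_bigr => r _; rewrite -[LHS]natn.
Qed.

Lemma leq_difference_count0 : (#|I| <= difference_count m a 0)%N.
Proof.
rewrite -(card_imset _ (_ : injective (fun i : I => (i, i)))) => [|i j [] //].
apply: subset_leq_card; apply/fintype.subsetP => p /imsetP[i _ ->].
by rewrite inE subrr.
Qed.

End DifferenceCount.

Section FourierDifferenceCount.
Variables (C : numClosedFieldType) (I : finType) (m : nat).
Variables (a : I -> int) (om : C).
Hypothesis om_prim : m.-primitive_root om.

Let m_gt0 : (0 < m)%N. Proof. exact: prim_order_gt0 om_prim. Qed.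

Lemma sqr_norm_prim_power_sum (nu : int) :
  `|power_sum (fun k => om ^ a k) nu| ^+ 2 =
  \sum_(p : I * I) om ^ (nu * (a p.1 - a p.2)).
Proof.
rewrite sqr_norm_power_sum => [|k]; last exact: norm_prim_exprz om_prim.
apply: eq_bigr => p _; rewrite invr_expz -expfzDr ?(prim_root_neq0 om_prim) //.
by rewrite exprz_exp mulrC.
Qed.

Lemma sqr_norm_power_sum_fourier (nu : int) :
  `|power_sum (fun k => om ^ a k) nu| ^+ 2 =
  \sum_(r < m) om ^ (nu * r%:Z) *+ difference_count m a r.
Proof.
rewrite sqr_norm_prim_power_sum.
apply: (sum_differences _ m_gt0 (F := fun r => om ^ (nu * r))) => r s /eqP rs.
apply/eqP; rewrite (eq_prim_exprz om_prim) eqz_mod_dvd.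
by rewrite -mulrBr dvdz_mull // -eqz_mod_dvd.
Qed.

Lemma difference_count_fourier (r : int) :
  m%:R * (difference_count m a r)%:R =
  \sum_(nu < m)
    `|power_sum (fun k => om ^ a k) nu| ^+ 2 * om ^ (- (nu%:Z * r)).
Proof.
under eq_bigr do rewrite sqr_norm_prim_power_sum mulr_suml.
rewrite exchange_big /=.
transitivity (\sum_(p : I * I)
    if (a p.1 - a p.2 == r %[mod m])%Z then m%:R else 0 : C).
  by rewrite -big_mkcond sumr_const mulr_natr.
apply: eq_bigr => p _; rewrite eqz_mod_dvd -(sum_prim_exprz om_prim).
apply: eq_bigr => nu _.
by rewrite -expfzDr ?(prim_root_neq0 om_prim) // -mulrBr.
Qed.

Lemma sqr_norm_power_sum_difference_set (c : nat) (nu : int) :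
    (forall r : nat, (0 < r < m)%N -> difference_count m a r = c) ->
    ~~ (m %| nu)%Z ->
  `|power_sum (fun k => om ^ a k) nu| ^+ 2 = (difference_count m a 0)%:R - c%:R.
Proof.
move=> count_c nu_ndvd; rewrite sqr_norm_power_sum_fourier.
rewrite (bigD1 (Ordinal m_gt0)) //= mulr0 expr0z; congr (_ + _).
under eq_bigr => r r_neq0.
  rewrite count_c ?ltn_ord ?andbT ?lt0n // -mulr_natr [nu * _]mulrC; over.
by rewrite -mulr_suml (sum_prim_exprz_neq0 om_prim) // mulN1r.
Qed.

Lemma difference_count_flat (c : C) (r : int) :
    (forall nu : nat, (0 < nu < m)%N ->
       `|power_sum (fun k => om ^ a k) nu| ^+ 2 = c) ->
    ~~ (m %| r)%Z ->
  m%:R * (difference_count m a r)%:R = #|I|%:R ^+ 2 - c.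
Proof.
move=> flat r_ndvd; rewrite difference_count_fourier.
rewrite (bigD1 (Ordinal m_gt0)) //= power_sum0 normr_nat mul0r mulr1.
congr (_ + _); under eq_bigr => nu nu_neq0.
  rewrite flat ?ltn_ord ?andbT ?lt0n // -mulrN; over.
by rewrite -mulr_sumr (sum_prim_exprz_neq0 om_prim) ?rpredN // mulrN1.
Qed.

End FourierDifferenceCount.

Section PerfectDifferenceSet.
Variable q : nat.
Local Notation m := (q ^ 2 + q + 1)%N.

Let m_gt0 : (0 < m)%N. Proof. by rewrite addn1. Qed.

Let natr_m (F : pzRingType) : m%:R = q%:R ^+ 2 + q%:R + 1 :> F.
Proof. by rewrite !natrD natrX. Qed.

Lemma perfect_difference_set_count (a : 'I_q.+1 -> int) :
    perfect_difference_set a ->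
  difference_count m a 0 = q.+1 /\
  forall r : nat, (0 < r < m)%N -> difference_count m a r = 1%N.
Proof.
move=> pds; pose lower (r : 'I_m) := if r == Ordinal m_gt0 then q.+1 else 1%N.
have lower_le (r : 'I_m) : (lower r <= difference_count m a r)%N.
  rewrite /lower; case: eqVneq => [-> | r_neq0].
    by have := leq_difference_count0 m a; rewrite card_ord.
  have [|i [j [_ ij]]] := pds r.
    by rewrite dvdzE /= gtnNdvd // lt0n.
  by apply/card_gt0P; exists (i, j); rewrite inE /= ij eqxx.
(* The trivial lower bounds already add up to the number of all pairs. *)
have sum_lower : (\sum_r lower r = \sum_(r < m) difference_count m a r)%N.
  rewrite sum_difference_count // card_ord (bigD1 (Ordinal m_gt0)) //=.
  rewrite {1}/lower eqxx; under eq_bigr => r r_neq0.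
    rewrite /lower (negPf r_neq0); over.
  rewrite sum1_card cardC1 card_ord addn1 -!mulnn.
  by rewrite mulSn mulnS [(q + _)%N]addnC.
have [_] := leqif_sum (fun r (_ : true) => leqif_eq (lower_le r)).
rewrite sum_lower eqxx => /esym/forallP lowerE.
split=> [|r /andP[r_gt0 r_lt]].
  by have /eqP <- := lowerE (Ordinal m_gt0); rewrite /lower eqxx.
by have /eqP <- := lowerE (Ordinal r_lt); rewrite /lower -val_eqE /= gtn_eqF.
Qed.

Lemma perfect_difference_setP (C : numClosedFieldType) (om : C)
    (a : 'I_q.+1 -> int) :
    m.-primitive_root om ->
  perfect_difference_set a <->
  forall nu : nat, (0 < nu < m)%N ->
    `|power_sum (fun k => om ^ a k) nu| ^+ 2 = q%:R.
Proof.
move=> om_prim; split=> [pds nu /andP[nu_gt0 nu_lt]|flat].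
  have [count0 count1] := perfect_difference_set_count pds.
  have nu_ndvd : ~~ (m %| nu%:Z)%Z by rewrite dvdzE /= gtnNdvd.
  rewrite (sqr_norm_power_sum_difference_set om_prim count1) //.
  by rewrite count0 -natrB ?subn1.
move=> r /negP r_ndvd.
have := difference_count_flat om_prim flat r_ndvd; rewrite card_ord => countE.
have : difference_count m a r != 0%N.
  apply/eqP => count0; move/esym/eqP: countE; rewrite count0 mulr0.
  rewrite (_ : _ - _ = m%:R) ?pnatr_eq0 ?gtn_eqF //.
  by rewrite natr_m -natr1; ring.
rewrite -lt0n => /card_gt0P[[i j]]; rewrite inE /= => ij.
exists i, j; split; last exact/eqP.
apply: contraNneq r_ndvd => ij_eq; move: ij.
by rewrite ij_eq subrr eq_sym eqz_mod_dvd subr0.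
Qed.

Lemma exists_perfect_difference_setP (C : numClosedFieldType) :
  (exists a : 'I_q.+1 -> int, perfect_difference_set a) <->
  exists2 z : 'I_q.+1 -> C, forall k, `|z k| = 1 &
    forall nu : nat, (0 < nu < m)%N -> `|power_sum z nu| ^+ 2 <= q%:R.
Proof.
have [|om om_prim] := @exists_prim_root C m; first by rewrite pnatr_eq0 -lt0n.
split=> [[a /(perfect_difference_setP _ om_prim) flat]|[z norm_z power_sum_le]].
  exists (fun k => om ^ a k) => [k|nu /flat->//].
  exact: norm_prim_exprz om_prim.
have tight : (m%:R - 1) * q%:R <= #|'I_q.+1|%:R * (m%:R - #|'I_q.+1|%:R) :> C.
  by rewrite card_ord natr_m -natr1 le_eqVlt; apply/orP; left; apply/eqP; ring.
have /all_sig[a aE] k : {i : 'I_m | z k / z ord0 = om ^+ i}.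
  exact/(prim_rootP om_prim)/(welch_equality_ratio norm_z power_sum_le tight).
exists (fun k => a k : int).
apply/(perfect_difference_setP _ om_prim) => nu nu_m.
rewrite -(welch_equality_sqr_norm norm_z power_sum_le tight nu_m).
have -> : power_sum z nu = z ord0 ^ nu * power_sum (fun k => om ^ a k) nu.
  rewrite -power_sumZ; apply: eq_bigr => k _; congr (_ ^ _).
  by rewrite -exprnP -aE mulrC divfK // -normr_gt0 norm_z.
by rewrite normrM -exprnP normrX norm_z expr1n mul1r.
Qed.

End PerfectDifferenceSet.

Lemma continuous_exprn (K : numFieldType) (nu : nat) :
  continuous (fun x : K => x ^+ nu).
Proof.
elim: nu => [|nu IHnu]; first exact: cst_continuous.
under eq_fun do rewrite exprS.
by move=> x; apply: (@continuousM K K id); last exact: IHnu.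
Qed.

Section ComplexTopology.
Variable R : realType.
(* [R[i]] carries a registered topology only through the alias [R[i]^o]. *)
Local Notation ctuple n := (prod_topology (fun _ : 'I_n => R[i]^o)).

Lemma norm_normc (x : R[i]) : `|x| = (Normc.normc x)%:C%C.
Proof. by case: x. Qed.

Lemma continuous_normc : continuous (@Normc.normc R : R[i]^o -> R).
Proof.
move=> x; apply/(@cvgrPdist_lt _ _ _ (nbhs (x : R[i]^o))) => e e_gt0; near=> y.
apply: le_lt_trans (ler_dist_dist (x : Rcomplex R) y) _.
rewrite -ltcR -norm_normc; near: y.
by apply: (@nbhsx_ballx R[i] R[i]^o); rewrite ltcR.
Unshelve. all: by end_near. Qed.

Lemma continuous_real_complex : continuous (real_complex R : R -> R[i]^o).
Proof.
move=> x; apply/cvgrPdist_lt => e e_gt0; near=> y.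
rewrite -rmorphB norm_normc -(RRe_real (gtr0_real e_gt0)) ltcR.
rewrite /= expr0n addr0 sqrtr_sqr; near: y; apply: (@nbhsx_ballx R R).
by move: e_gt0; rewrite ltcE => /andP[].
Unshelve. all: by end_near. Qed.

Lemma compact_unit_circle :
  compact [set x : R[i]^o | Normc.normc x = 1]%classic.
Proof.
pose f (p : R * R) : R[i]^o := p.1%:C%C + 'i%C * p.2%:C%C.
have f_cont : continuous f.
  move=> p; apply: cvgD; last apply: cvgM; first 1 last.
  - exact: cvg_cst.
  - exact: (continuous_comp cvg_snd (@continuous_real_complex _)).
  - exact: (continuous_comp cvg_fst (@continuous_real_complex _)).
apply: (@subclosed_compact _ _ (f @` (`[-1, 1] `*` `[-1, 1]))%classic).
- apply: (@preimage_closed _ _ _ [set x : R | x = 1]%classic).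
    by move=> x _; exact: continuous_normc.
  exact: closed_eq.
- apply: continuous_compact; first exact: continuous_subspaceT.
  by apply: compact_setX; exact: segment_compact.
move=> [x y] /= /(congr1 (fun t => t ^+ 2)).
rewrite sqr_sqrtr ?addr_ge0 ?sqr_ge0 // expr1n => sqr_norm_xy.
exists (x, y); last by rewrite /f [RHS]complexE.
split; rewrite /= in_itv /= -ler_norml -(@expr_le1 _ 2) //;
  rewrite real_normK ?num_real //.
  by rewrite -sqr_norm_xy lerDl sqr_ge0.
by rewrite -sqr_norm_xy lerDr sqr_ge0.
Qed.

Lemma compact_unimodular (n : nat) :
  compact ([set z | unimodular z]%classic : set (ctuple n)).
Proof. exact: (tychonoff (fun _ : 'I_n => compact_unit_circle)). Qed.

Lemma continuous_max_power_sum (n : nat) :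
  continuous (@max_power_sum R n : ctuple n -> R).
Proof.
have power_sum_cont (nu : nat) : continuous
    (fun z : ctuple n => \sum_k z k ^+ nu : R[i]^o).
  apply: (continuous_big (U := R[i]^o)) => [|k _ z].
    exact: add_continuous.
  have coord_cont := @proj_continuous _ (fun=> R[i]^o) k z.
  exact: (continuous_comp coord_cont (@continuous_exprn _ nu _)).
rewrite /max_power_sum.
apply: (continuous_big (U := R)) => [|nu _ z]; first exact: max_continuous.
exact: (continuous_comp (power_sum_cont nu z) (@continuous_normc _)).
Qed.

Lemma max_power_sum_leP (n : nat) (z : 'I_n -> R[i]) (x : R) : 0 <= x ->
  max_power_sum z <= x <-> forall nu : nat, (0 < nu < (n ^ 2 - n).+1)%N ->
    Normc.normc (\sum_k z k ^+ nu) <= x.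
Proof.
move=> x_ge0; split=> [le_x nu nu_n|le_x].
  apply: le_trans le_x.
  apply: (@le_bigmax_seq _ _ _ _ 0 nu xpredT
    (fun nu => Normc.normc (\sum_k z k ^+ nu))) => //.
  by rewrite mem_index_iota.
rewrite /max_power_sum big_seq; apply: bigmax_le => // nu.
by rewrite mem_index_iota => /le_x.
Qed.

Lemma inf_max_power_sum_leP (n : nat) (x : R) :
  inf_max_power_sum R n <= x <->
  exists2 z : 'I_n -> R[i], unimodular z & max_power_sum z <= x.
Proof.
split=> [inf_le_x|[z norm_z]].
  have unimodular_neq0 : ([set z : ctuple n | unimodular z] !=set0)%classic.
    by exists (fun=> 1) => k; exact: Normc.normc1.
  have [z /set_mem z_unimodular z_min] := compact_EVT_min unimodular_neq0
    (@compact_unimodular n)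
    (continuous_subspaceT (@continuous_max_power_sum n)).
  exists z => //; apply: le_trans inf_le_x; apply: lb_le_inf.
    by exists (max_power_sum z), z.
  by move=> _ [u u_unimodular <-]; apply: z_min; rewrite inE.
apply: le_trans; apply: ge_inf; last by exists z.
by exists 0 => _ [u _ <-]; exact: bigmax_ge_id.
Qed.

Lemma unimodularP (n : nat) (z : 'I_n -> R[i]) :
  unimodular z <-> forall k, `|z k| = 1.
Proof.
split=> norm_z k; first by rewrite norm_normc norm_z.
by apply: complexI; rewrite -norm_normc norm_z.
Qed.

Lemma sqr_norm_le_sqrt (x : R[i]) (y : R) :
  0 <= y -> (`|x| ^+ 2 <= y%:C%C) = (Normc.normc x <= Num.sqrt y).
Proof.
move=> y_ge0; rewrite norm_normc -rmorphXn lecR -ler_sqrt // sqrtr_sqr.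
by rewrite ger0_norm // (normr_ge0 (x : Rcomplex R)).
Qed.

Lemma max_power_sum_le_sqrtP (q : nat) (z : 'I_q.+1 -> R[i]) :
  max_power_sum z <= Num.sqrt q%:R <->
  forall nu : nat, (0 < nu < q ^ 2 + q + 1)%N -> `|power_sum z nu| ^+ 2 <= q%:R.
Proof.
have modulusE : (q.+1 ^ 2 - q.+1).+1 = (q ^ 2 + q + 1)%N.
  by rewrite -!mulnn mulSnr addnK mulnS addn1 addnC.
have sqr_le nu : (`|power_sum z nu| ^+ 2 <= q%:R) =
    (Normc.normc (power_sum z nu) <= Num.sqrt q%:R).
  by rewrite -sqr_norm_le_sqrt ?ler0n // rmorph_nat.
apply: (iff_trans (max_power_sum_leP z (sqrtr_ge0 _))); rewrite modulusE.
by split=> le_z nu nu_m; have := le_z nu nu_m; rewrite sqr_le.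
Qed.

Lemma inf_max_power_sum_le_sqrtP (q : nat) :
  inf_max_power_sum R q.+1 <= Num.sqrt q%:R <->
  exists a : 'I_q.+1 -> int, perfect_difference_set a.
Proof.
apply: iff_trans (iff_sym (exists_perfect_difference_setP q R[i])).
apply: (iff_trans (inf_max_power_sum_leP _ _)).
by split=> -[z /unimodularP norm_z /max_power_sum_le_sqrtP le_z]; exists z.
Qed.

End ComplexTopology.

Theorem corollary2 (R : realType) :
  (forall q : nat, (0 < q)%N ->
     (exists a : 'I_q.+1 -> int, @perfect_difference_set q a) -> prime_power q)
  <->
  (forall n : nat, (2 <= n)%N -> ~ prime_power (n - 1)%N ->
     Num.sqrt ((n - 1)%N%:R : R) < inf_max_power_sum R n).
Proof.
split=> [ppc [//|q] q_gt0|inf_gt q q_gt0 pds].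
  rewrite subn1 => not_pp; rewrite ltNge; apply/negP.
  by move=> /inf_max_power_sum_le_sqrtP/(ppc q q_gt0).
apply: contrapT => not_pp; have := inf_gt q.+1 q_gt0.
rewrite subn1 => /(_ not_pp); rewrite ltNge => /negP; apply.
exact/inf_max_power_sum_le_sqrtP.
Qed.
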